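(* Let $\mathfrak C$ be a left cancellative small category. Then $\mathrm{Iso}(\bar I_l\ltimes\partial\Omega)^\circ=\bar I_l^c\ltimes\partial\Omega$ (the interior of the isotropy subgroupoid). Moreover, the following are equivalent: (i) $I_l\,\bar\ltimes\,\partial\Omega\cong\bar I_l\ltimes\partial\Omega$ is effective. (ii) $\bar I_l^c\ltimes\partial\Omega=\partial\Omega$. (iii) For all $s\in\bar I_l^c$ there exist $\varepsilon_1,\dots,\varepsilon_n\in\bar{\mathcal J}$ with $s\varepsilon_i=\varepsilon_i$ for all $1\le i\le n$ such that for all $g\in\mathcal J$ with $\emptyset\ne g\le s^{-1}s$ there exists $1\le i\le n$ with $g\varepsilon_i\ne\emptyset$.
   Context: $\mathfrak C$ denotes the set of morphisms, $\mathfrak C^0\subseteq\mathfrak C$ the identity morphisms, $\mathfrak d,\mathfrak t$ domain and target; $cd$ is defined iff $\mathfrak d(c)=\mathfrak t(d)$; left cancellative means $cx=cy\Rightarrow x=y$. Each $c\in\mathfrak C$ gives the partial bijection $\mathfrak d(c)\mathfrak C\to c\mathfrak C$, $x\mapsto cx$; $I_l$ is the smallest semigroup of partial bijections of $\mathfrak C$ containing these and closed under inverses; $\mathcal J=\{\mathrm{dom}(s):s\in I_l\}$ is its semilattice of idempotents. $\bar{\mathcal J}$ is the set of subsets $\varepsilon=e\setminus\bigcup_{i=1}^nf_i$ of $\mathfrak C$ with $e,f_1,\dots,f_n\in\mathcal J$, $f_i\subseteq e$. $\bar I_l$ is the inverse semigroup of all partial bijections $s\varepsilon$ (restriction of $s$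 to $\varepsilon$) with $s\in I_l$, $\varepsilon\in\bar{\mathcal J}$, $\varepsilon\subseteq\mathrm{dom}(s)$; its semilattice of idempotents is $\bar{\mathcal J}$. Idempotents are identified with subsets of $\mathfrak C$: products are intersections, $\le$ is inclusion, $s^{-1}s=\mathrm{dom}(s)$, $ses^{-1}=s(e\cap\mathrm{dom}(s))$, and $s\varepsilon=\varepsilon$ means $\varepsilon\subseteq\mathrm{dom}(s)$ and $s(x)=x$ for $x\in\varepsilon$. $\widehat{\mathcal J}$ is the space of non-zero multiplicative maps $\chi:\mathcal J\to\{0,1\}$ with $\chi(\emptyset)=0$ if $\emptyset\in\mathcal J$ (pointwise convergence). $\Omega\subseteq\widehat{\mathcal J}$ consists of those $\chi$ such that whenever $e=\bigcup_{i=1}^nf_i$ ($e,f_i\in\mathcal J$) and $\chi(e)=1$, then $\chi(f_i)=1$ for some $i$. For $\chi\in\Omega$, $\varepsilon=e\setminus\bigcup f_i\in\bar{\mathcal J}$, put $\chi(\varepsilon)=1$ iff $\chi(e)=1$ and all $\chi(f_i)=0$, and $\chi(\varepsilon)=0$ otherwise. $\partial\Omega\subseteq\Omega$ is the closure of the set $\Omega_{\max}$ of $\chi\in\widehat{\mathcal J}$ with $\chi^{-1}(1)$ maximal. $\bar I_l$ acts on $\Omega$ and $\partial\Omega$: $s$ maps $\{\chi(s^{-1}s)=1\}$ onto $\{\chi(ss^{-1})=1\}$ by $(s.\chi)(f)=\chi(s^{-1}fs)$. $\bar I_l\ltimes\partial\Omega$ is the groupoid of classes $[s,\chi]$ with $s\in\bar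 I_l$, $\chi\in\partial\Omega$, $\chi(s^{-1}s)=1$, where $[s,\chi]=[t,\psi]$ iff $\chi=\psi$ and $s\varepsilon=t\varepsilon$ for some $\varepsilon\in\bar{\mathcal J}$ with $\chi(\varepsilon)=1$; source $\chi$, range $s.\chi$; topology such that the sets $\{[s,\chi]:\chi(s^{-1}s)=1\}$ are open and mapped homeomorphically by the source map onto $\{\chi\in\partial\Omega:\chi(s^{-1}s)=1\}$. $I_l\,\bar\ltimes\,\partial\Omega$ is defined in the same way with $s\in I_l$ only (same equivalence relation); the inclusion $I_l\subseteq\bar I_l$ induces an isomorphism $I_l\,\bar\ltimes\,\partial\Omega\cong\bar I_l\ltimes\partial\Omega$. $\bar I_l^f:=\{s\in\bar I_l:\exists f\in\mathcal J,\ \emptyset\ne f\le s^{-1}s\}$; $\bar I_l^c:=\{s\in\bar I_l^f: e(ses^{-1})\ne\emptyset\ \forall e\in\mathcal J\text{ with }\emptyset\ne e\le s^{-1}s\}$; $\bar I_l^c\ltimes\partial\Omega:=\{[s,\chi]\in\bar I_l\ltimes\partial\Omega:s\in\bar I_l^c\}$. An étale groupoid is effective if the interior of its isotropy subgroupoid equals its unit space. *)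

(* Defs.v *)
From HB Require Import structures.
From mathcomp Require Import all_boot.
From mathcomp Require Import all_classical all_analysis.

Set Implicit Arguments.
Unset Strict Implicit.
Unset Printing Implicit Defensive.

Local Open Scope classical_set_scope.
Local Open Scope quotient_scope.

(* Small categories in arrows-only form: objects are identified with identity
   morphisms. The composite [mcomp c d] is meaningful only when
   [mdom c = mtgt d]; the value on other pairs is never used. *)
Record smallCategory := SmallCategory {
  mor :> Type;
  mdom : mor -> mor;
  mtgt : mor -> mor;
  mcomp : mor -> mor -> mor;
  mdom_dom : forall c, mdom (mdom c) = mdom c;
  mtgt_dom : forall c, mtgt (mdom c) = mdom c;
  mdom_tgt : forall c, mdom (mtgt c) = mtgt c;
  mtgt_tgt : forall c, mtgt (mtgt c) = mtgt c;
  mdom_comp : forall c d, mdom c = mtgt d -> mdom (mcomp c d) = mdom d;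
  mtgt_comp : forall c d, mdom c = mtgt d -> mtgt (mcomp c d) = mtgt c;
  mcompA : forall b c d, mdom b = mtgt c -> mdom c = mtgt d ->
    mcomp b (mcomp c d) = mcomp (mcomp b c) d;
  mcomp_dom : forall c, mcomp c (mdom c) = c;
  mcomp_tgt : forall c, mcomp (mtgt c) c = c }.

Definition left_cancellative (C : smallCategory) :=
  forall c x y : C, mdom c = mtgt x -> mdom c = mtgt y ->
    mcomp c x = mcomp c y -> x = y.

Record lcCategory := LcCategory {
  lcCategory_cat :> smallCategory;
  lcCategoryP : left_cancellative lcCategory_cat }.

Section PartialMaps.
Context {T : Type}.
Implicit Types (s t : set (T * T)) (A : set T).

(* Partial maps are represented by their graphs: [s (x, y)] means y = s(x).
   The composite and inverse are [(s \; t)%relation] (t first) and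
   [(s^-1)%relation]. *)
Definition partial_bij s :=
  (forall x y y', s (x, y) -> s (x, y') -> y = y') /\
  (forall x x' y, s (x, y) -> s (x', y) -> x = x').

Definition pdom s : set T := [set x | exists y, s (x, y)].

Definition pimg s A : set T := [set y | exists2 x, A x & s (x, y)].

Definition pid A : set (T * T) := [set p | A p.1 /\ p.1 = p.2].

Definition pres s A : set (T * T) := (s \; pid A)%relation.

Lemma presE s A x y : pres s A (x, y) <-> A x /\ s (x, y).
Proof.
split=> [[z [/= Ax <-]]//|[Ax sxy]].
by exists x.
Qed.

End PartialMaps.

Section InverseSemigroups.
Variable C : lcCategory.

(* The ideal d(c)C is {x | t(x) = d(c)}. *)
Definition lmul (c : C) : set (C * C) :=
  [set p | mdom c = mtgt p.1 /\ p.2 = mcomp c p.1].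

Inductive Il : set (C * C) -> Prop :=
| Il_lmul c : Il (lmul c)
| Il_mul s t : Il s -> Il t -> Il (s \; t)%relation
| Il_inv s : Il s -> Il (s^-1)%relation.

Definition J : set (set C) := [set pdom s | s in Il].

Definition Jbar : set (set C) :=
  [set eps | exists (e : set C) (n : nat) (f : 'I_n -> set C),
    [/\ J e, forall i, J (f i) /\ f i `<=` e & eps = e `\` \bigcup_i f i]].

Definition Ilbar : set (set (C * C)) :=
  [set t | exists s eps, [/\ Il s, Jbar eps, eps `<=` pdom s & t = pres s eps]].

Definition Ilbar_f : set (set (C * C)) :=
  [set s | Ilbar s /\ exists f, [/\ J f, f !=set0 & f `<=` pdom s]].

Definition Ilbar_c : set (set (C * C)) :=
  [set s | Ilbar_f s /\
    forall e, J e -> e !=set0 -> e `<=` pdom s -> (e `&` pimg s e) !=set0].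

(* {ptws J -> bool} carries the topology of pointwise convergence. *)
Definition charT : Type := {ptws J -> bool}.
HB.instance Definition _ := Topological.on charT.

(* Multiplicativity is stated through the underlying sets: e f is the
   intersection of e and f. *)
Definition Jhat : set charT :=
  [set chi : charT | [/\ exists e : J, chi e,
    forall e f g : J, \val g = \val e `&` \val f -> chi g = chi e && chi f &
    forall e : J, \val e = set0 -> chi e = false]].

Definition Omega : set charT :=
  [set chi : charT | Jhat chi /\
    forall (e : J) (n : nat) (f : 'I_n -> J),
      \val e = \bigcup_i \val (f i) -> chi e -> exists i, chi (f i)].

Definition Omega_max : set charT :=
  [set chi : charT | Jhat chi /\
    forall psi, Jhat psi -> (forall e : J, chi e -> psi e) -> psi = chi].

Definition bOmega : set charT := Omega `&` closure Omega_max.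

(* The value chi(eps) for eps in Jbar; for chi in Omega it does not depend on
   the way eps is written. *)
Definition chi_bar (chi : charT) (eps : set C) : bool :=
  `[< exists (e : J) (n : nat) (f : 'I_n -> J),
      [/\ forall i, \val (f i) `<=` \val e,
          eps = \val e `\` \bigcup_i \val (f i),
          chi e & forall i, ~~ chi (f i)] >].

(* (s . chi)(f) = chi(s^-1 f s), where s^-1 f s is the preimage of f. *)
Definition act (s : set (C * C)) (chi : charT) : charT :=
  fun f => chi_bar chi (pimg (s^-1)%relation (\val f)).

Definition act_dom (s : set (C * C)) : set charT :=
  [set chi : charT | bOmega chi /\ chi_bar chi (pdom s)].

Lemma lmul_bij c : partial_bij (lmul c).
Proof.
split=> [x y y' [_ /= ->] [_ /= ->]//|x x' y [/= h1 ->] [/= h2 h]].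
exact: (lcCategoryP h1 h2 h).
Qed.

Lemma Il_bij s : Il s -> partial_bij s.
Proof.
elim=> {s} [c|s t _ [s1 s2] _ [t1 t2]|s _ [s1 s2]]; first exact: lmul_bij.
  split=> [x y y'|x x' y] [z /= tz sz] [z' /= tz' sz'].
    by rewrite (t1 _ _ _ tz' tz) in sz'; exact: s1 sz sz'.
  by rewrite (s2 _ _ _ sz' sz) in tz'; exact: t2 tz tz'.
by split=> [x y y' /= h h'|x x' y /= h h']; [exact: s2 h h'|exact: s1 h h'].
Qed.

Lemma Il_pid e : J e -> Il (pid e).
Proof.
case=> s Is <-; have [s1 s2] := Il_bij Is.
suff -> : pid (pdom s) = (s^-1 \; s)%relation.
  by apply: Il_mul => //; exact: Il_inv.
apply/seteqP; split=> [[x y] [[z /= sxz] <-]|[x y] [z /= sxz syz]].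
  by exists z.
by split; [exists z|exact: s2 sxz syz].
Qed.

Lemma J_pimg s e : Il s -> J e -> J (pimg (s^-1)%relation e).
Proof.
move=> Is Je; exists (pid e \; s)%relation; first exact: Il_mul (Il_pid Je) Is.
apply/seteqP; split=> [x [y [z /= sxz [/= ez _]]]|x [y ey /= sxy]].
  by exists z.
by exists y, y.
Qed.

Lemma J_setI e f : J e -> J f -> J (e `&` f).
Proof.
move=> Je Jf; rewrite (_ : e `&` f = pimg ((pid e)^-1)%relation f).
  exact: J_pimg (Il_pid Je) Jf.
apply/seteqP; split=> [x [ex fx]|x [y fy [/= ex xy]]]; first by exists x.
by split=> //; rewrite xy.
Qed.

Lemma Jbar_J e : J e -> Jbar e.
Proof.
move=> Je; exists e, 0, (fun=> set0); split=> // [[]//|].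
by rewrite (_ : \bigcup_i _ = set0) ?setD0// bigcup0.
Qed.

Lemma Jbar_setI A B : Jbar A -> Jbar B -> Jbar (A `&` B).
Proof.
move=> [e [n [f [Je Jf ->]]]] [e' [n' [f' [Je' Jf' ->]]]].
exists (e `&` e'), (n + n')%N,
  (fun k => match fintype.split k with
            | inl i => f i `&` e' | inr j => f' j `&` e end).
split; first exact: J_setI.
  move=> k; case: (fintype.split k) => [i|j].
    have [Jfi fe] := Jf i; split; first exact: J_setI.
    by apply: setSI.
  have [Jfj fe] := Jf' j; split; first exact: J_setI.
  by rewrite [e `&` _]setIC; apply: setSI.
apply/seteqP; split=> [x [[ex nf] [e'x nf']]|x [[ex e'x] nf]].
  split=> // -[k _]; case: (fintype.split k) => [i|j] /= [h _].
    by apply: nf; exists i.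
  by apply: nf'; exists j.
split; split=> // -[i _ fx]; apply: nf.
  exists (lshift n' i) => //.
  by rewrite (unsplitK (inl i : 'I_n + 'I_n')).
exists (rshift n i) => //.
by rewrite (unsplitK (inr i : 'I_n + 'I_n')).
Qed.

Lemma chi_barP (chi : charT) eps : reflect
  (exists (e : J) (n : nat) (f : 'I_n -> J),
      [/\ forall i, \val (f i) `<=` \val e,
          eps = \val e `\` \bigcup_i \val (f i),
          chi e & forall i, ~~ chi (f i)]) (chi_bar chi eps).
Proof. exact: asboolP. Qed.

Definition inJ e (Je : J e) : J := exist _ e (mem_set Je).

Lemma valJ (e : J) : J (\val e). Proof. exact: set_valP. Qed.

Lemma chi_bar_Jbar chi eps : chi_bar chi eps -> Jbar eps.
Proof.
move=> /chi_barP[e [n [f [fe -> _ _]]]].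
exists (\val e), n, (fun i => \val (f i)).
by split=> //; [exact: valJ|move=> i; split=> //; exact: valJ].
Qed.

Lemma chi_bar_setI chi A B : Jhat chi ->
  chi_bar chi A -> chi_bar chi B -> chi_bar chi (A `&` B).
Proof.
move=> [_ chiM _] /chi_barP[e [n [f [fe -> ce cf]]]].
move=> /chi_barP[e' [n' [f' [fe' -> ce' cf']]]].
apply/chi_barP.
exists (inJ (J_setI (valJ e) (valJ e'))), (n + n')%N,
  (fun k => match fintype.split k with
            | inl i => inJ (J_setI (valJ (f i)) (valJ e'))
            | inr j => inJ (J_setI (valJ (f' j)) (valJ e)) end).
split.
- move=> k; case: (fintype.split k) => [i|j] /=.
    by apply: setSI; exact: fe.
  by rewrite [X in _ `<=` X]setIC; apply: setSI; exact: fe'.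
- apply/seteqP; split=> [x [[ex nf] [e'x nf']]|x [[ex e'x] nf]].
    split=> // -[k _]; case: (fintype.split k) => [i|j] /= [h _].
      by apply: nf; exists i.
    by apply: nf'; exists j.
  split; split=> // -[i _ fx]; apply: nf.
    exists (lshift n' i) => //.
    by rewrite (unsplitK (inl i : 'I_n + 'I_n')).
  exists (rshift n i) => //.
  by rewrite (unsplitK (inr i : 'I_n + 'I_n')).
- by rewrite (chiM e e') ?ce.
- move=> k; case: (fintype.split k) => [i|j].
    by rewrite (chiM (f i) e')// (negbTE (cf i)).
  by rewrite (chiM (f' j) e)// (negbTE (cf' j)).
Qed.

Lemma chi_bar_sub chi A B : Omega chi ->
  chi_bar chi A -> Jbar B -> A `<=` B -> chi_bar chi B.
Proof.
move=> [[_ chiM _] chiU] /chi_barP[e [n [f [fe -> ce cf]]]].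
move=> [e' [n' [f' [Je' Jf' ->]]]] AB; apply/chi_barP.
have ce' : chi (inJ Je').
  pose g k := if unlift ord0 k is Some i then f i
              else inJ (J_setI (valJ e) Je').
  have [|k] := chiU e n.+1 g _ ce.
    apply/seteqP; split=> [x ex|x [k _]]; last first.
      by rewrite /g; case: unliftP => [i|] _ => [/fe//|[]].
    have [[i _ fx]|nf] := pselect ((\bigcup_i \val (f i)) x).
      by exists (lift ord0 i) => //; rewrite /g liftK.
    exists ord0 => //; rewrite /g unlift_none /=; split=> //.
    by have [] := AB x (conj ex nf).
  rewrite /g; case: unliftP => [i|] _; first by rewrite (negbTE (cf i)).
  by rewrite (chiM e (inJ Je'))// => /andP[].
exists (inJ Je'), n', (fun j => inJ (Jf' j).1); split=> // [j|j].
  exact: (Jf' j).2.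
apply/negP => cf'.
have [||i] := chiU (inJ (J_setI (valJ e) (Jf' j).1)) n
  (fun i => inJ (J_setI (valJ (f i)) (Jf' j).1)).
- apply/seteqP; split=> [x [/= ex fx]|x [i _ [/= fx f'x]]]; last first.
    by split=> //; exact: fe fx.
  have [[i _ fix_]|nf] := pselect ((\bigcup_i \val (f i)) x).
    by exists i.
  by have [_ []] := AB x (conj ex nf); exists j.
- by rewrite (chiM e (inJ (Jf' j).1))// ce.
- by rewrite (chiM (f i) (inJ (Jf' j).1))// (negbTE (cf i)).
Qed.

Lemma Il_Ilbar s : Il s -> Ilbar s.
Proof.
move=> Is; exists s, (pdom s); split=> //; first by apply: Jbar_J; exists s.
apply/seteqP; split=> -[x y]; last by move=> /presE[].
by move=> sxy; apply/presE; split=> //; exists y.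
Qed.

Lemma Jbar_pimg s e : Ilbar s -> J e -> Jbar (pimg (s^-1)%relation e).
Proof.
move=> [t [eps [It Jeps _ ->]]] Je.
rewrite (_ : pimg _ e = eps `&` pimg (t^-1)%relation e).
  by apply: Jbar_setI => //; exact/Jbar_J/J_pimg.
apply/seteqP; split=> [x [y ey]|x [epsx [y ey /= txy]]].
  by move=> /presE [epsx txy]; split=> //; exists y.
by exists y => //; apply/presE.
Qed.

Section Germs.
(* The groupoid attached to a set S of partial bijections, with the germ
   relation defined through Jbar; S is Il or Ilbar below. *)
Variable S : set (set (C * C)).

(* Pairs (s, chi) with s in S, chi in bOmega and chi(s^-1 s) = 1, topologized
   as the disjoint union over s of the subspaces act_dom s. *)
Definition pregerm : Type := {s : S & set_type (act_dom (\val s))}.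
HB.instance Definition _ := Topological.on pregerm.

Definition pg_map (p : pregerm) : set (C * C) := \val (projT1 p).
Definition pg_chi (p : pregerm) : charT := \val (projT2 p).

Lemma pg_chiP p : bOmega (pg_chi p).
Proof. by case: (set_valP (projT2 p)). Qed.

Definition germ_rel' (p q : pregerm) : bool :=
  `[< pg_chi p = pg_chi q /\
      exists eps, [/\ Jbar eps, chi_bar (pg_chi p) eps &
                      pres (pg_map p) eps = pres (pg_map q) eps] >].

Lemma germ_rel_refl : reflexive germ_rel'.
Proof.
move=> p; apply/asboolP; split=> //; have [_ h] := set_valP (projT2 p).
by exists (pdom (pg_map p)); split=> //; exact: chi_bar_Jbar h.
Qed.

Lemma germ_rel_sym : symmetric germ_rel'.
Proof.
move=> p q; apply/asboolP/asboolP => -[h [eps [Je ce he]]];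
by (split; first exact/esym); exists eps; split=> //; move: ce; rewrite h.
Qed.

Lemma germ_rel_trans : transitive germ_rel'.
Proof.
move=> q p r /asboolP[h [eps [Je ce he]]] /asboolP[h' [eps' [Je' ce' he']]].
apply/asboolP; split; first by rewrite h.
exists (eps `&` eps'); split; first exact: Jbar_setI.
  apply: chi_bar_setI => //; last by rewrite h.
  by case: (pg_chiP p) => -[].
apply/seteqP; split=> -[x y] /presE[[ex e'x] sxy]; apply/presE; split=> //.
  have : pres (pg_map p) eps (x, y) by apply/presE.
  rewrite he => /presE[_ qxy].
  have : pres (pg_map q) eps' (x, y) by apply/presE.
  by rewrite he' => /presE[].
have : pres (pg_map r) eps' (x, y) by apply/presE.
rewrite -he' => /presE[_ qxy].
have : pres (pg_map q) eps (x, y) by apply/presE.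
by rewrite -he => /presE[].
Qed.

Definition germ_rel :=
  EquivRel germ_rel' germ_rel_refl germ_rel_sym germ_rel_trans.

(* The quotient topology, spelled out in germ_openP, is the one for which the
   sets {[s, chi] | chi in act_dom s} are open and mapped homeomorphically
   onto act_dom s by the source map. *)
Definition germ : Type := {eq_quot germ_rel}.
HB.instance Definition _ := Quotient.on germ.
HB.instance Definition _ := Topological.copy germ (quotient_topology germ).

Lemma germ_openP (U : set germ) : open U <-> forall s : S,
  open [set chi : set_type (act_dom (\val s)) |
        U (\pi_germ (existT _ s chi : pregerm))].
Proof. exact: (sigT_openP (\pi_germ @^-1` U : set pregerm)). Qed.

Definition germ_src (g : germ) : charT := pg_chi (repr g).

Definition germ_rng (g : germ) : charT :=
  act (pg_map (repr g)) (pg_chi (repr g)).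

Lemma germ_srcE p : germ_src (\pi_germ p) = pg_chi p.
Proof. by rewrite /germ_src; case: piP => q /eqmodP/asboolP[]. Qed.

Lemma germ_rngE p : S `<=` Ilbar ->
  germ_rng (\pi_germ p) = act (pg_map p) (pg_chi p).
Proof.
move=> SI; rewrite /germ_rng; case: piP => q /eqmodP/asboolP.
move=> [hc [eps [Je ce he]]]; rewrite -hc; apply/funext => f.
have Ochi : Omega (pg_chi p) by case: (pg_chiP p).
have SP (r : pregerm) : Ilbar (pg_map r) by apply/SI/set_valP.
have key u v (A := pimg (pg_map u)^-1%relation (\val f))
    (B := pimg (pg_map v)^-1%relation (\val f)) :
    pres (pg_map u) eps = pres (pg_map v) eps ->
    chi_bar (pg_chi p) A -> chi_bar (pg_chi p) B.
  move=> uv cA; apply: (chi_bar_sub Ochi (chi_bar_setI Ochi.1 cA ce)).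
    exact: Jbar_pimg (SP v) (valJ f).
  move=> x [[y fy /= uxy] ex]; exists y => //=.
  have : pres (pg_map u) eps (x, y) by apply/presE.
  by rewrite uv => /presE[].
by rewrite /act; apply/idP/idP; apply: key.
Qed.

Definition isotropy : set germ := [set g | germ_rng g = germ_src g].

(* The set of the classes [s, chi] that have a representative with s in P. *)
Definition germs_of (P : set (set (C * C))) : set germ :=
  [set (\pi_germ p) | p in [set p | P (pg_map p)]].

(* chi in bOmega is identified with [e, chi], e any idempotent (partial
   identity) in S with chi(e) = 1. *)
Definition germ_units : set germ := germs_of (range pid).

Definition effective : Prop := isotropy° = germ_units.

End Germs.

End InverseSemigroups.

Arguments J : clear implicits.
Arguments Jbar : clear implicits.
Arguments Il : clear implicits.
Arguments Ilbar : clear implicits.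
Arguments Ilbar_f : clear implicits.
Arguments Ilbar_c : clear implicits.
Arguments isotropy {C} S.
Arguments germs_of {C} S P.
Arguments germ_units {C} S.
Arguments effective {C} S.

(* Main.v *)
(* A maximal character vanishes at f only if it is 1 at some e in J disjoint
   from f, and every nonempty e in J lies in a maximal character. Together they
   turn "e meets s(e) for all nonempty e below dom(s)" into "s fixes every
   maximal character in its domain", hence, by density and continuity, every
   character of the boundary in its domain. So [s, chi] is interior to the
   isotropy iff some restriction of s to a set of Jbar containing chi satisfies
   that condition. It is a unit iff some such restriction is an identity; a
   pointwise choice of these restrictions is made finite by compactness of the
   domain of s in the boundary. The argument applies to any set of partial
   bijections between I_l and its completion, hence to both groupoids. *)

Require Import Defs.
From HB Require Import structures.
From mathcomp Require Import all_boot.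
From mathcomp Require Import all_classical all_analysis.

Set Implicit Arguments.
Unset Strict Implicit.
Unset Printing Implicit Defensive.

Local Open Scope classical_set_scope.

(** * Maximal characters and orthogonality *)

Section Characters.
Context {C : lcCategory}.
Implicit Types (chi psi : charT C) (A B : set C) (e f g : J C).

Definition meetJ e f : J C := inJ (J_setI (valJ e) (valJ f)).

Lemma Jhat_meetJ chi e f : Jhat chi -> chi (meetJ e f) = chi e && chi f.
Proof. by move=> [_ chiM _]; exact: chiM. Qed.

Lemma Jhat_nonempty chi e : Jhat chi -> chi e -> \val e !=set0.
Proof.
move=> [_ _ chi0] ce; apply/set0P/eqP => e0.
by move: ce; rewrite (chi0 e e0).
Qed.

(** The witnesses [h] are intersected with [e] one at a time; finite intersections keep the value
    1. *)
Lemma Jhat_orth chi n (A : 'I_n -> set C) e : Jhat chi -> chi e ->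
    (forall i, exists2 h, chi h & \val h `&` A i = set0) ->
  exists2 g, chi g & \val g `<=` \val e /\ forall i, \val g `&` A i = set0.
Proof.
move=> Jchi; elim: n A e => [|n IHn] A e ce Ah.
  by exists e => //; split=> // -[].
have [h ch hA0] := Ah ord0.
have [||g cg [ge gA]] := IHn (fun i => A (lift ord0 i)) (meetJ e h).
- by rewrite Jhat_meetJ// ce.
- by move=> i; exact: Ah.
exists g => //; split=> [x /ge[]//|i].
case: (unliftP ord0 i) => [j ->//|->].
by rewrite -subset0 -hA0 => x [/ge[]].
Qed.

(** Zorn's lemma for supports of characters: two members of the union of a chain lie in one set of
    the chain, so the union is again a support. *)
Lemma Jhat_max psi : Jhat psi ->
  exists2 chi, Omega_max chi & forall e, psi e -> chi e.
Proof.
move=> Jpsi; have [[d pd] _ _] := Jpsi.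
pose chr (X : set (J C)) : charT C := fun e => `[< X e >].
pose P (X : set (J C)) :=
  X = set0 \/ ((forall e, psi e -> X e) /\ Jhat (chr X)).
have PJ X e : P X -> X e -> Jhat (chr X) by move=> [->//|[]].
have [F FP Ftot|X [PX Xmax]] := @Zorn_bigcup (J C) P.
  have [[X0 [FX0 [e0 X0e0]]]|F0] :=
      pselect (exists X, F X /\ X !=set0); last first.
    left; rewrite -subset0 => e [X FX Xe].
    by apply: F0; exists X; split=> //; exists e.
  have [X00|[psiX0 JX0]] := FP _ FX0; first by move: X0e0; rewrite X00.
  right; split=> [e pe|]; first by exists X0 => //; exact: psiX0.
  split; first by exists e0; apply/asboolP; exists X0.
  - move=> e f g gE; apply/asboolP/andP => [[X FX Xg]|].
      have [_ XM _] := PJ _ _ (FP _ FX) Xg.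
      have : chr X g by apply/asboolP.
      by rewrite (XM e f)// => /andP[/asboolP Xe /asboolP Xf];
         split; apply/asboolP; exists X.
    move=> [/asboolP[X FX Xe] /asboolP[Y FY Yf]].
    have [XY|YX] := Ftot _ _ FX FY.
      exists Y => //; have [_ YM _] := PJ _ _ (FP _ FY) Yf.
      apply/asboolP; rewrite -/(chr Y g) (YM e f)//.
      by apply/andP; split; apply/asboolP => //; exact: XY.
    exists X => //; have [_ XM _] := PJ _ _ (FP _ FX) Xe.
    apply/asboolP; rewrite -/(chr X g) (XM e f)//.
    by apply/andP; split; apply/asboolP => //; exact: YX.
  - move=> e e0'; apply/asboolP => -[X FX Xe].
    have [_ _ /(_ e e0')] := PJ _ _ (FP _ FX) Xe.
    by move=> /asboolP.
have Ppsi : P [set e | psi e].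
  right; split=> //; rewrite (_ : chr _ = psi)//.
  by apply/funext => e; exact: asboolb.
have [X0|[psiX JX]] := PX.
  exfalso; apply: (Xmax [set e | psi e]) => //; rewrite X0.
  by split=> // /(_ d pd).
exists (chr X); last by move=> e /psiX Xe; apply/asboolP.
split=> // phi Jphi Xphi; apply/funext => e.
apply/idP/asboolP => [phie|Xe]; last first.
  by apply: Xphi; apply/asboolP.
apply: contrapT => nXe; apply: (Xmax [set e | phi e]).
  split=> [h Xh|]; first by apply: Xphi; apply/asboolP.
  by move=> /(_ e phie).
right; split=> [h /psiX Xh|]; first by apply: Xphi; apply/asboolP.
rewrite (_ : chr _ = phi)//.
by apply/funext => h; exact: asboolb.
Qed.

(** The sets of [J] through a fixed point of [e] support a character, which extends to a maximal
    one. *)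
Lemma Omega_max_nonempty e : \val e !=set0 ->
  exists2 chi, Omega_max chi & chi e.
Proof.
move=> [x ex]; pose psi : charT C := fun f => `[< (\val f : set C) x >].
have Jpsi : Jhat psi.
  split=> [|f g h hE|f f0]; first by exists e; apply/asboolP.
    apply/asboolP/andP; first by rewrite hE => -[? ?]; split; apply/asboolP.
    by move=> [/asboolP ? /asboolP ?]; rewrite hE.
  by apply/asboolP; rewrite f0.
have [chi cmax psichi] := Jhat_max Jpsi.
by exists chi => //; apply: psichi; apply/asboolP.
Qed.

(** If [f] met every [e] with [chi e], the sets containing such an intersection would support a
    character above [chi] with value 1 at [f], against maximality. *)
Lemma Omega_max_orth chi f : Omega_max chi -> ~~ chi f ->
  exists2 e, chi e & \val e `&` \val f = set0.
Proof.
move=> [Jchi cmax] nf; apply: contrapT => nex.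
have fmeet e : chi e -> \val e `&` \val f !=set0.
  by move=> ce; apply/set0P/eqP => ef; apply: nex; exists e.
pose psi : charT C :=
  fun g => `[< exists2 e, chi e & \val e `&` \val f `<=` \val g >].
have chipsi e : chi e -> psi e by move=> ce; apply/asboolP; exists e => // x [].
have [[d cd] chiM chi0] := Jchi.
have Jpsi : Jhat psi.
  split=> [|e e' g gE|e e0]; first by exists d; exact: chipsi.
    apply/asboolP/andP.
      by move=> [h ch]; rewrite gE subsetI => -[he he'];
         split; apply/asboolP; exists h.
    move=> [/asboolP[h ch he] /asboolP[h' ch' he']]; exists (meetJ h h').
      by rewrite Jhat_meetJ// ch.
    rewrite gE => x [[hx h'x] fx].
    by split; [exact: he|exact: he'].
  apply/asboolP => -[h ch]; rewrite e0 => h0.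
  by have [x /h0] := fmeet h ch.
move: nf; rewrite -(cmax psi)// => /asboolP; apply.
by exists d => // x [].
Qed.

Lemma Omega_max_orthP chi n e (f : 'I_n -> J C) : Omega_max chi -> chi e ->
  (forall i, ~~ chi (f i)) ->
  exists2 g, chi g & \val g `<=` \val e `\` \bigcup_i \val (f i).
Proof.
move=> cmax ce cf.
have [|g cg [ge gf]] := @Jhat_orth chi n (fun i => \val (f i)) e cmax.1 ce.
  by move=> i; exact: Omega_max_orth.
exists g => // x gx; split; first exact: ge.
by move=> [i _ fx]; rewrite -[False]/(set0 x) -(gf i).
Qed.

Lemma Omega_max_Omega : @Omega_max C `<=` @Omega C.
Proof.
move=> chi cmax; split; first exact: cmax.1.
move=> e n f eE ce; apply: contrapT => nf.
have [|g cg] := Omega_max_orthP (f := f) cmax ce.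
  by move=> i; apply/negP => cf; apply: nf; exists i.
by rewrite eE setDv subset0 => g0; have [_ _ /(_ g g0)] := cmax.1; rewrite cg.
Qed.

Lemma Omega_max_bOmega : @Omega_max C `<=` @bOmega C.
Proof.
by move=> chi cmax; split; [exact: Omega_max_Omega|exact: subset_closure].
Qed.

Lemma Omega_max_chi_bar chi A : Omega_max chi -> chi_bar chi A ->
  exists2 g, chi g & \val g `<=` A.
Proof.
by move=> cmax /chi_barP[e [n [f [_ -> ce cf]]]]; exact: Omega_max_orthP.
Qed.

(** * Values of characters on [Jbar] *)

Lemma Jbar_valP A : Jbar C A -> exists e n (f : 'I_n -> J C),
  (forall i, \val (f i) `<=` \val e) /\ A = \val e `\` \bigcup_i \val (f i).
Proof.
move=> [e [n [f [Je Jf ->]]]].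
exists (inJ Je), n, (fun i => inJ (Jf i).1); split=> // i.
exact: (Jf i).2.
Qed.

Lemma chi_bar_nonempty chi A : Omega chi -> chi_bar chi A -> A !=set0.
Proof.
move=> [_ chiU] /chi_barP[e [n [f [fe -> ce cf]]]]; apply/set0P/eqP => A0.
have [|i] := chiU e n f _ ce; last by rewrite (negbTE (cf i)).
apply/seteqP; split=> [|x [i _ /fe//]].
by rewrite -setD_eq0 A0.
Qed.

(** If [e] is [d] minus the [f i], then [e] and the [f i] cover [d]; the covering property of
    [Omega] forces [chi e]. *)
Lemma chi_bar_J chi e : Omega chi -> chi_bar chi (\val e) = chi e.
Proof.
move=> Ochi; apply/idP/idP => [/chi_barP[d [n [f [fd eE cd cf]]]]|ce].
  have ed : \val e `<=` \val d by rewrite eE => x [].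
  apply: contrapT => ne.
  pose g k := if unlift ord0 k is Some i then f i else e.
  have [|i] := Ochi.2 d n.+1 g _ cd; rewrite /g.
    apply/seteqP; split=> [x dx|x [k _]]; last first.
      by case: unliftP => [i|] _ => [/fd|/ed].
    have [[i _ fx]|nf] := pselect ((\bigcup_i \val (f i)) x).
      by exists (lift ord0 i); rewrite // liftK.
    by exists ord0; rewrite // unlift_none eE.
  by case: unliftP => [j|] _; [rewrite (negbTE (cf j))|move/ne].
apply/chi_barP; exists e, 0, (fun=> e); split=> //; try by case.
by rewrite (_ : \bigcup_i _ = set0) ?setD0// -subset0 => x [[]].
Qed.

Lemma chi_bar_disjoint chi A B : Omega chi -> chi_bar chi A -> A `&` B = set0 ->
  ~~ chi_bar chi B.
Proof.
move=> Ochi cA AB; apply/negP => cB.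
by have := chi_bar_nonempty Ochi (chi_bar_setI Ochi.1 cA cB); rewrite AB => -[].
Qed.

(** Monotonicity yields [chi e] and disjointness excludes the [f i]; hence every presentation of a
    set of [Jbar] gives the same value. *)
Lemma chi_barE chi e n (f : 'I_n -> J C) : Omega chi ->
  (forall i, \val (f i) `<=` \val e) ->
  chi_bar chi (\val e `\` \bigcup_i \val (f i)) =
  chi e && [forall i, ~~ chi (f i)].
Proof.
move=> Ochi fe; apply/idP/andP => [cA|[ce /forallP cf]]; last first.
  by apply/chi_barP; exists e, n, f.
split.
  rewrite -chi_bar_J//; apply: (chi_bar_sub Ochi cA); last exact: subDsetl.
  exact/Jbar_J/valJ.
apply/forallP => i; rewrite -chi_bar_J//; apply: (chi_bar_disjoint Ochi cA).
by rewrite -subset0 => x [[_ nf] fx]; apply: nf; exists i.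
Qed.

(** * Topology of the character space and compactness of domains *)

Lemma near_char chi e : \forall psi \near chi, psi e = chi e.
Proof.
have cvg := @proj_continuous (J C) (fun=> bool) e chi.
by apply: (cvg [set chi e]); exact: discrete_set1.
Qed.

Lemma near_chars chi n (f : 'I_n -> J C) :
  \forall psi \near chi, forall i, psi (f i) = chi (f i).
Proof.
have h := @filter_forall _ _ (fun i psi => psi (f i) = chi (f i)) (nbhs chi) _.
by apply: h => i; exact: near_char.
Qed.

(** Only the finitely many coordinates in one presentation of [A] matter. *)
Lemma near_chi_bar chi A : Omega chi -> Jbar C A ->
  \forall psi \near chi, Omega psi -> chi_bar psi A = chi_bar chi A.
Proof.
move=> Ochi /Jbar_valP[e [n [f [fe ->]]]].
apply: filterS2 (near_char chi e) (near_chars chi f) => psi pe pf Opsi.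
rewrite !chi_barE// pe; congr (_ && _).
by apply: eq_forallb => i; rewrite pf.
Qed.

(** The sets [W] with this property form a filter, so its convergence to [chi] need only be tested
    on single coordinates. *)
Lemma nbhs_chi_bar chi (W : set (charT C)) : Omega chi -> nbhs chi W ->
  exists2 A, chi_bar chi A & forall psi, Omega psi -> chi_bar psi A -> W psi.
Proof.
move=> Ochi.
pose F : set_system (charT C) := [set W | exists2 A, chi_bar chi A &
  forall psi, Omega psi -> chi_bar psi A -> W psi].
have [[d cd] _ _] := Ochi.1.
have FF : Filter F.
  split.
  - by exists (\val d) => //; rewrite chi_bar_J.
  - move=> P Q [A cA AP] [B cB BQ]; exists (A `&` B).
      exact: chi_bar_setI Ochi.1 cA cB.
    move=> psi Opsi cAB; split; [apply: AP|apply: BQ] => //.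
      by apply: chi_bar_sub cAB (chi_bar_Jbar cA) _ => // x [].
    by apply: chi_bar_sub cAB (chi_bar_Jbar cB) _ => // x [].
  - by move=> P Q PQ [A cA AP]; exists A => // psi Opsi /(AP _ Opsi)/PQ.
suff : F --> chi by exact.
apply/cvg_sup => e U [V] [[Q] _ <-] /= Qe QU.
suff [A cA AQ] : F (@proj _ (fun=> bool) e @^-1` Q).
  by exists A => // psi Opsi /(AQ _ Opsi)/QU.
have [ce|ce] := boolP (chi e).
  exists (\val e); first by rewrite chi_bar_J.
  by move=> psi Opsi; rewrite chi_bar_J// => pe; move: Qe;
    rewrite /preimage/= /proj ce pe.
(* The value 0 at [e] is expressed by removing [e] from some [d] of value 1; removed sets must lie
   in [d], hence the intersection. *)
pose f (_ : 'I_1) := meetJ d e.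
have fd i : \val (f i) `<=` \val d by move=> x [].
exists (\val d `\` \bigcup_i \val (f i)).
  rewrite chi_barE// cd; apply/forallP => i.
  by rewrite Jhat_meetJ ?(negbTE ce) ?andbF//; exact: Ochi.1.
move=> psi Opsi; rewrite chi_barE// => /andP[pd /forallP/(_ ord0)].
rewrite Jhat_meetJ ?pd/=; last exact: Opsi.1.
by move=> /negbTE pe; move: Qe; rewrite /preimage/= /proj (negbTE ce) pe.
Qed.

Lemma bOmega_approx chi (P : set (charT C)) : bOmega chi ->
  (\forall psi \near chi, Omega psi -> P psi) ->
  exists2 psi, Omega_max psi & P psi.
Proof.
move=> [_ cl] nP; have [psi [pmax pP]] := cl _ nP.
by exists psi => //; apply: pP; exact: Omega_max_Omega.
Qed.

Lemma bOmega_chi_bar_max chi A : bOmega chi -> chi_bar chi A ->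
  exists2 psi, Omega_max psi & chi_bar psi A.
Proof.
move=> Bchi cA; apply: (bOmega_approx Bchi).
by apply: filterS (near_chi_bar Bchi.1 (chi_bar_Jbar cA)) => psi pA /pA ->.
Qed.

(** Multiplicativity, the covering property and the value at [pdom s] involve finitely many
    coordinates at a time, where a limit point agrees with some member. *)
Lemma closed_act_dom (s : set (C * C)) : Jbar C (pdom s) -> closed (act_dom s).
Proof.
move=> Js chi cl.
have agree n (f : 'I_n -> J C) :
    exists psi, act_dom s psi /\ forall i, psi (f i) = chi (f i).
  by apply: cl; exact: near_chars.
have agree1 e : exists psi, act_dom s psi /\ psi e = chi e.
  have [psi [? h]] := agree 1 (fun=> e).
  by exists psi; split=> //; exact: h ord0.
have := Js; move=> /Jbar_valP[e [n [f [fe sE]]]].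
(* Being nonzero is not a closed condition in general; here all members have value 1 at the same
   [e], which passes to the limit. *)
have ce : chi e.
  have [psi [[[Opsi _] +] <-]] := agree1 e.
  by rewrite sE chi_barE// => /andP[].
have Ochi : Omega chi.
  split.
    split; first by exists e.
    - move=> a b c cE.
      have [psi [[[[[_ psiM _] _] _] _] h]] := agree 3 (tnth [tuple a; b; c]).
      have := h ord0; have := h (lift ord0 ord0); have := h ord_max.
      by rewrite !(tnth_nth a)/= => <- <- <-; exact: psiM.
    - move=> a a0; have [psi [[[[[_ _ psi0] _] _] _] <-]] := agree1 a.
      exact: psi0.
  move=> a m b aE ca.
  have [psi [[[[_ psiU] _] _] h]] :=
    agree m.+1 (fun k => if unlift ord0 k is Some i then b i else a).
  have [|i pb] := psiU a m b aE.
    by have := h ord0; rewrite unlift_none => ->.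
  by exists i; have := h (lift ord0 i); rewrite liftK => <-.
split; first split=> //.
  have /closure_subset/(_ _ cl) : act_dom s `<=` closure (@Omega_max C).
    by move=> psi [[]].
  by rewrite -(closure_id _).1//; exact: closed_closure.
rewrite sE chi_barE// ce; apply/forallP => i.
have [psi [[[Opsi _] +] <-]] := agree1 (f i).
by rewrite sE chi_barE// => /andP[_ /forallP].
Qed.

Lemma compact_act_dom (s : set (C * C)) :
  Jbar C (pdom s) -> compact (act_dom s).
Proof.
move=> Js; apply: (@subclosed_compact _ _ [set: charT C]) => //.
  exact: closed_act_dom.
have := @tychonoff (J C) (fun=> bool) (fun=> setT) (fun=> bool_compact).
by rewrite (_ : [set f | _] = setT)//; apply/seteqP.
Qed.

End Characters.

(** * Restriction of partial maps *)

Section Restriction.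
Context {T : Type}.
Implicit Types (s : set (T * T)) (A B : set T).

Lemma pdom_pres s A : pdom (pres s A) = A `&` pdom s.
Proof.
apply/seteqP; split=> [x [y /presE[Ax sxy]]|x [Ax [y sxy]]].
  by split=> //; exists y.
by exists y; apply/presE.
Qed.

Lemma pres_pres s A B : pres (pres s A) B = pres s (A `&` B).
Proof.
apply/seteqP; split=> -[x y].
  by move=> /presE[Bx /presE[Ax sxy]]; apply/presE.
by move=> /presE[[Ax Bx] sxy]; apply/presE; split=> //; apply/presE.
Qed.

Lemma pimg_inv_pres s A B :
  pimg (pres s A)^-1%relation B = A `&` pimg s^-1%relation B.
Proof.
apply/seteqP; split=> [x [y By /presE[Ax sxy]]|x [Ax [y By sxy]]].
  by split=> //; exists y.
by exists y => //; apply/presE.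
Qed.

Lemma pdom_pid A : pdom (pid A) = A.
Proof. by apply/seteqP; split=> [x [y []]|x Ax]//; exists x. Qed.

Lemma pres_pid A B : pres (pid A) B = pid (A `&` B).
Proof.
apply/seteqP; split=> -[x y]; first by move=> /presE[Bx [/= Ax xy]].
by move=> [/= [Ax Bx] xy]; apply/presE.
Qed.

Lemma pres_fixP s A : partial_bij s ->
  pres s A = pid A <-> forall x, A x -> s (x, x).
Proof.
move=> [sfun _]; split=> [sA x Ax|sA].
  suff : pres s A (x, x) by move=> /presE[].
  by rewrite sA.
apply/seteqP; split=> -[x y].
  by move=> /presE[Ax sxy]; split=> //=; exact: sfun (sA _ Ax) sxy.
by move=> [/= Ax <-]; apply/presE; split=> //; exact: sA.
Qed.

End Restriction.

(** * The action on characters and its fixed points *)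

Section Actions.
Context {C : lcCategory}.
Implicit Types (chi psi : charT C) (A B : set C) (e f g : J C).
Implicit Types (s : set (C * C)).

Lemma Ilbar_bij s : Ilbar C s -> partial_bij s.
Proof.
move=> [t [A [It _ _ ->]]]; have [tf ti] := Il_bij It.
split=> [x y y' /presE[_ +] /presE[_]|x x' y /presE[_ +] /presE[_]].
  exact: tf.
exact: ti.
Qed.

Lemma Ilbar_pres s A : Ilbar C s -> Jbar C A -> Ilbar C (pres s A).
Proof.
move=> [t [B [It JB Bt ->]]] JA; exists t, (B `&` A).
split=> //; [exact: Jbar_setI|by move=> x [/Bt]|exact: pres_pres].
Qed.

Lemma Jbar_pdom s : Ilbar C s -> Jbar C (pdom s).
Proof.
by move=> [t [A [It JA At ->]]]; rewrite pdom_pres setIidl.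
Qed.

Lemma Ilbar_f_chi s chi : Ilbar C s -> act_dom s chi -> Ilbar_f C s.
Proof.
move=> Is [Bchi cs]; split=> //.
have [psi pmax ps] := bOmega_chi_bar_max Bchi cs.
have [g pg gs] := Omega_max_chi_bar pmax ps.
by exists (\val g); split=> //; [exact: valJ|exact: Jhat_nonempty pmax.1 pg].
Qed.

Lemma act_dom_pres s A chi : Ilbar C s -> Jbar C A ->
  act_dom (pres s A) chi <-> act_dom s chi /\ chi_bar chi A.
Proof.
move=> Is JA; rewrite /act_dom/= pdom_pres; split=> [[Bchi cA]|[[Bchi cs] cA]].
  split; first split=> //.
    by apply: chi_bar_sub Bchi.1 cA (Jbar_pdom Is) _ => // x [].
  by apply: chi_bar_sub Bchi.1 cA JA _ => // x [].
by split=> //; exact: chi_bar_setI Bchi.1.1 cA cs.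
Qed.

Lemma act_pres s A chi : Ilbar C s -> act_dom (pres s A) chi -> Jbar C A ->
  act (pres s A) chi = act s chi.
Proof.
move=> Is /[swap] JA /(act_dom_pres _ Is JA)[[Bchi cs] cA].
apply/funext => f; rewrite /act pimg_inv_pres.
apply/idP/idP => [cAf|cf]; last exact: chi_bar_setI Bchi.1.1 cA cf.
apply: chi_bar_sub Bchi.1 cAf _ _; first exact: Jbar_pimg Is (valJ f).
by move=> x [].
Qed.

Lemma Ilbar_c_pres s A : Ilbar_c C s -> Ilbar_f C (pres s A) ->
  Ilbar_c C (pres s A).
Proof.
move=> [_ sc] sf; split=> // e Je e0; rewrite pdom_pres subsetI => -[eA es].
have [y [ey [x ex sxy]]] := sc e Je e0 es.
by exists y; split=> //; exists x => //; apply/presE; split=> //; exact: eA.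
Qed.

(** On [e] the map [s] agrees with some [t] in [Il], whose preimages of sets of [J] are in [J] and
    not merely in [Jbar]. *)
Lemma J_pimg_dom s e f : Ilbar C s -> \val e `<=` pdom s ->
  exists g : J C, \val g = \val e `&` pimg s^-1%relation (\val f).
Proof.
move=> [t [A [It _ _ ->]]]; rewrite pdom_pres subsetI => -[eA _].
exists (inJ (J_setI (valJ e) (J_pimg It (valJ f)))).
by rewrite pimg_inv_pres setIA (setIidl eA).
Qed.

Lemma act_max s chi f : Ilbar_c C s -> Omega_max chi -> chi_bar chi (pdom s) ->
  chi_bar chi (pimg s^-1%relation (\val f)) = chi f.
Proof.
move=> [[Is _] sc] cmax cs; have Jchi := cmax.1.
have Ochi := Omega_max_Omega cmax.
have [g cg gs] := Omega_max_chi_bar cmax cs.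
have [h hE] := J_pimg_dom f Is gs.
have cf k : chi k -> \val k `<=` \val g ->
    exists2 x, \val k x & exists2 y, s (x, y) & \val k y.
  move=> ck kg.
  have := sc _ (valJ k) (Jhat_nonempty Jchi ck) (subset_trans kg gs).
  by move=> [y [ky [x kx sxy]]]; exists x => //; exists y.
have -> : chi_bar chi (pimg s^-1%relation (\val f)) = chi h.
  rewrite -chi_bar_J// hE; apply/idP/idP => [cp|ch].
    by apply: chi_bar_setI Jchi _ cp; rewrite chi_bar_J.
  by apply: chi_bar_sub Ochi ch (Jbar_pimg Is (valJ f)) _ => x [].
apply/idP/idP => [ch|ce]; apply: contrapT => /negP n.
  (* Some point of [e] and [h] is sent into [e], and into [f] since it lies in [h]; but [e] and [f]
     are disjoint. *)
  have [e ce ef] := Omega_max_orth cmax n.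
  have [||x [ex hx] [y sxy [ey _]]] := cf (meetJ e h).
  - by rewrite Jhat_meetJ// ce.
  - by move=> x [_]; rewrite /= hE => -[].
  move: hx; rewrite hE => -[_ [y' fy' sxy']].
  rewrite -[False]/(set0 y) -ef; split=> //.
  by rewrite ((Ilbar_bij Is).1 _ _ _ sxy sxy').
(* Some point common to [e], [g] and [f] is sent into [f], hence lies in [h]; but [e] and [h] are
   disjoint. *)
have [e ce' eh] := Omega_max_orth cmax n.
have [||x [ex [gx fx]] [y sxy [_ [_ fy]]]] := cf (meetJ e (meetJ g f)).
- by rewrite !Jhat_meetJ// ce' cg.
- by move=> x [_ []].
by rewrite -[False]/(set0 x) -eh hE; split=> //; split=> //; exists y.
Qed.

(** For each [f], some maximal character shares with [chi] the values at [pdom s], at the preimage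
    of [f] and at [f], so [act_max] applies. *)
Lemma act_Ilbar_c s chi : Ilbar_c C s -> act_dom s chi -> act s chi = chi.
Proof.
move=> sc [Bchi cs]; have Is := sc.1.1; apply/funext => f; rewrite /act.
set P := pimg _ _; have JP : Jbar C P by exact: Jbar_pimg Is (valJ f).
have [psi pmax [ps pP pf]] : exists2 psi, Omega_max psi &
   [/\ chi_bar psi (pdom s), chi_bar psi P = chi_bar chi P & psi f = chi f].
  apply: (bOmega_approx Bchi).
  have Js := Jbar_pdom Is.
  apply: filterS3 (near_chi_bar Bchi.1 Js) (near_chi_bar Bchi.1 JP)
    (near_char chi f) => psi h1 h2 h3 Opsi.
  by split=> //; [rewrite h1|rewrite h2].
by rewrite -pP -pf; exact: act_max.
Qed.

(** A maximal character with value 1 at [e] is fixed, so it has value 1 at the preimage of [e],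
    which therefore meets [e]. *)
Lemma act_fixed_Ilbar_c s : Ilbar_f C s ->
  (forall psi, act_dom s psi -> act s psi = psi) -> Ilbar_c C s.
Proof.
move=> sf fixs; split=> // e Je e0 es; have Is := sf.1.
have [psi pmax pe] := Omega_max_nonempty (e := inJ Je) e0.
have Opsi := Omega_max_Omega pmax.
have pe' : chi_bar psi e by rewrite (chi_bar_J (inJ Je)).
have /fixs sp : act_dom s psi.
  split; first exact: Omega_max_bOmega.
  exact: chi_bar_sub Opsi pe' (Jbar_pdom Is) es.
have : act s psi (inJ Je) by rewrite sp.
move=> /(chi_bar_setI Opsi.1 pe')/(chi_bar_nonempty Opsi)[x [ex [y ey sxy]]].
by exists y; split=> //; exists x.
Qed.

End Actions.

(** * Germs: units and the interior of the isotropy *)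

Section Germs.
Local Open Scope quotient_scope.
Context {C : lcCategory} (S : set (set (C * C))).
Hypothesis SIlbar : S `<=` Ilbar C.
Implicit Types (p q : pregerm S) (chi : charT C) (A B : set C).

Definition mkpg s chi (Ss : S s) (h : act_dom s chi) : pregerm S :=
  existT _ (exist _ s (mem_set Ss) : S) (exist _ chi (mem_set h)).

Lemma pg_mapP p : S (pg_map p).
Proof. exact: set_valP. Qed.

Lemma pg_map_Ilbar p : Ilbar C (pg_map p).
Proof. exact/SIlbar/pg_mapP. Qed.

Lemma pg_act_dom p : act_dom (pg_map p) (pg_chi p).
Proof. exact: set_valP. Qed.

Lemma pi_germP p q : \pi_(germ S) p = \pi_(germ S) q <->
  pg_chi p = pg_chi q /\
  exists2 A, chi_bar (pg_chi p) A & pres (pg_map p) A = pres (pg_map q) A.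
Proof.
split=> [/eqmodP/asboolP[h [A [_ cA pA]]]|[h [A cA pA]]].
  by split=> //; exists A.
apply/eqmodP/asboolP; split=> //; exists A; split=> //.
exact: chi_bar_Jbar cA.
Qed.

(* The restriction need not lie in S. *)
Definition germ_c p :=
  exists2 A, chi_bar (pg_chi p) A & Ilbar_c C (pres (pg_map p) A).

Definition germ_fix p :=
  exists2 A, chi_bar (pg_chi p) A & pres (pg_map p) A = pid A.

Lemma pg_Ilbar_f p A : chi_bar (pg_chi p) A -> Ilbar_f C (pres (pg_map p) A).
Proof.
move=> cA; have JA := chi_bar_Jbar cA; have Ip := pg_map_Ilbar p.
apply: (Ilbar_f_chi (chi := pg_chi p) (Ilbar_pres Ip JA)).
by apply/(act_dom_pres _ Ip JA); split=> //; exact: pg_act_dom.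
Qed.

(** Both representatives agree on [A], and [Ilbar_c] survives the further restriction of the first
    one from [B] to the intersection with [A]. *)
Lemma germ_c_sat p q : \pi_(germ S) p = \pi_(germ S) q -> germ_c p -> germ_c q.
Proof.
move=> /pi_germP[cpq [A cA pqA]] [B cB pB].
have cAB := chi_bar_setI (pg_chiP p).1.1 cA cB.
exists (A `&` B); first by rewrite -cpq.
rewrite -pres_pres -pqA pres_pres setIC -pres_pres; apply: Ilbar_c_pres => //.
by rewrite pres_pres setIC; exact: pg_Ilbar_f.
Qed.

Lemma germ_unitsP p : Il C `<=` S ->
  germ_units S (\pi_(germ S) p) <-> germ_fix p.
Proof.
move=> IS; split=> [[q [B _ qB] /pi_germP[cqp [A cA qpA]]]|[A cA pA]].
  have cB : chi_bar (pg_chi q) B.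
    by rewrite -[B]pdom_pid qB; exact: (pg_act_dom q).2.
  exists (A `&` B).
    by rewrite -cqp; exact: chi_bar_setI (pg_chiP q).1.1 cA cB.
  by rewrite -pres_pres -qpA -qB pres_pid pres_pid setIAC setIid setIC.
(* [pid A] may lie outside [S]; the identity on the ambient set [e] of a presentation of [A] lies in
   [Il] and has the same germ. *)
have /chi_barP[e [n [f [_ AE ce _]]]] := cA.
have Ae : A `<=` \val e by rewrite AE => x [].
have de : act_dom (pid (\val e)) (pg_chi p).
  split; first exact: pg_chiP.
  by rewrite pdom_pid chi_bar_J//; exact: (pg_chiP p).1.
exists (mkpg (IS _ (Il_pid (valJ e))) de); first by exists (\val e).
apply/pi_germP; split=> //; exists A => //.
by rewrite pA [LHS]pres_pid setIC setIidl.
Qed.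

Lemma isotropyE p :
  isotropy S (\pi_(germ S) p) <-> act (pg_map p) (pg_chi p) = pg_chi p.
Proof. by rewrite /isotropy/= germ_rngE// germ_srcE. Qed.

Lemma set_type_open (T : topologicalType) (D : set T) (U : set (set_type D))
    (x : set_type D) :
  open U -> U x -> exists2 W : set T, nbhs (\val x) W &
    forall y : set_type D, W (\val y) -> U y.
Proof.
move=> [W oW <-] Wx; exists W => //.
exact: open_nbhs_nbhs.
Qed.

(** If [s] fixes all characters in a basic neighbourhood given by [A], its restriction to [A] is in
    [Ilbar_c]. Conversely one [A] serves all nearby characters, so the germs with [germ_c] form an
    open set, and they are isotropic. *)
Lemma interior_isotropyP p : (isotropy S)° (\pi_(germ S) p) <-> germ_c p.
Proof.
split=> [ip|cp].
  have /germ_openP/(_ (projT1 p)) := @open_interior _ (isotropy S).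
  case: p ip => s chi ip oI; have [W nW WI] := set_type_open oI ip.
  have [Bchi cs] := set_valP chi.
  have [A cA AW] := nbhs_chi_bar Bchi.1 nW.
  have JA := chi_bar_Jbar cA.
  have Is : Ilbar C (\val s) by exact/SIlbar/set_valP.
  exists A => //; apply: act_fixed_Ilbar_c.
    exact: (pg_Ilbar_f (p := existT _ s chi)).
  move=> psi pA; rewrite act_pres//.
  have [ps pA'] := (act_dom_pres psi Is JA).1 pA.
  pose chi' : set_type (act_dom (\val s)) := SigSub (mem_set ps).
  have /WI/interior_subset/isotropyE : W (\val chi').
    by apply: AW => //; exact: ps.1.1.
  by [].
pose U : set (germ S) := [set g | germ_c (repr g)].
have UE q : U (\pi_(germ S) q) <-> germ_c q.
  by split; apply: germ_c_sat; rewrite ?reprK.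
apply: (@filterS _ _ _ U).
  move=> g; rewrite -[g]reprK => /UE; move: (repr g) => q [A cA qA].
  have JA := chi_bar_Jbar cA; have Iq := pg_map_Ilbar q.
  have dA : act_dom (pres (pg_map q) A) (pg_chi q).
    by apply/act_dom_pres => //; split=> //; exact: pg_act_dom.
  by apply/isotropyE; rewrite -(act_pres Iq dA JA); exact: act_Ilbar_c.
apply: open_nbhs_nbhs; split; last exact/UE.
apply/germ_openP => s; rewrite openE => chi /UE[A cA sA].
have Ochi : Omega (\val chi) by case: (set_valP chi) => -[].
have h : nbhs chi (\val @^-1` [set psi | Omega psi -> chi_bar psi A]).
  apply: initial_continuous.
  by apply: filterS (near_chi_bar Ochi (chi_bar_Jbar cA)) => psi + Opsi => ->.
apply: filterS h => psi pA; apply/UE; exists A => //; apply: pA.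
by case: (set_valP psi) => -[].
Qed.

Lemma effectiveP : Il C `<=` S ->
  effective S <-> forall p, germ_c p -> germ_fix p.
Proof.
move=> IS; split=> [eff p /interior_isotropyP|cf].
  by rewrite eff => /(germ_unitsP _ IS).
apply/seteqP; split=> g; rewrite -[g]reprK.
  by move=> /interior_isotropyP/cf/(germ_unitsP _ IS).
(* Units lie in the interior: an identity maps each nonempty [e] in its domain onto itself. *)
move=> /(germ_unitsP _ IS)[A cA pA]; apply/interior_isotropyP; exists A => //.
split=> [|e Je [x ex]]; first exact: pg_Ilbar_f.
rewrite pdom_pres subsetI => -[eA _]; exists x; split=> //.
by exists x => //; rewrite pA; split=> //; exact: eA.
Qed.

End Germs.

(** * Effectiveness and finite covers by fixed sets *)

Section FixedCovers.
Context {C : lcCategory}.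

Definition fixed_covers := forall s, Ilbar_c C s ->
  exists (n : nat) (eps : 'I_n -> set C),
    (forall i, Jbar C (eps i) /\ pres s (eps i) = pid (eps i)) /\
    (forall g, J C g -> g !=set0 -> g `<=` pdom s ->
       exists i, (g `&` eps i) !=set0).

(* If no eps i had the value 1 at chi, the same would hold at a nearby maximal
   character, which would then contain some g meeting none of the eps i. *)
Lemma fixed_cover_chi (s : set (C * C)) chi n (eps : 'I_n -> set C) :
  Ilbar C s -> act_dom s chi -> (forall i, Jbar C (eps i)) ->
  (forall g, J C g -> g !=set0 -> g `<=` pdom s ->
     exists i, (g `&` eps i) !=set0) ->
  exists i, chi_bar chi (eps i).
Proof.
move=> Is [Bchi cs] Jeps cov; apply: contrapT => neps.
have [psi pmax [ps peps]] : exists2 psi, Omega_max psi &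
    chi_bar psi (pdom s) /\ forall i, ~~ chi_bar psi (eps i).
  apply: (bOmega_approx Bchi).
  have nF : \forall psi \near chi, forall i,
      Omega psi -> chi_bar psi (eps i) = chi_bar chi (eps i).
    have h := @filter_forall _ _ (fun i psi =>
      Omega psi -> chi_bar psi (eps i) = chi_bar chi (eps i)) (nbhs chi) _.
    by apply: h => i; exact: near_chi_bar Bchi.1 (Jeps i).
  apply: filterS2 nF (near_chi_bar Bchi.1 (Jbar_pdom Is)) => psi pe ps Opsi.
  split=> [|i]; first by rewrite ps.
  by rewrite pe//; apply/negP => ce; apply: neps; exists i.
have [g pg gs] := Omega_max_chi_bar pmax ps.
have [|h ph [hg heps]] := Jhat_orth (A := eps) pmax.1 pg.
  move=> i; have Opsi := Omega_max_Omega pmax.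
  have [e [m [f [fe epsE]]]] := Jbar_valP (Jeps i).
  (* Value 0 at [eps i] means value 0 at the ambient [e] or value 1 at some removed [f j]; either
     way a set of value 1 misses [eps i]. *)
  have := peps i; rewrite epsE chi_barE// negb_and => /orP[ne|].
    have [h ph he] := Omega_max_orth pmax ne.
    by exists h => //; rewrite -subset0 -he => x [hx [ex _]].
  rewrite negb_forall => /existsP[j]; rewrite negbK => pf.
  by exists (f j) => //; rewrite -subset0 => x [fx [_ nf]]; apply: nf; exists j.
have [i] := cov _ (valJ h) (Jhat_nonempty pmax.1 ph) (subset_trans hg gs).
by rewrite heps => -[].
Qed.

Lemma effective_fixed_covers (S : set (set (C * C))) :
  Il C `<=` S -> S `<=` Ilbar C -> effective S <-> fixed_covers.
Proof.
move=> IS SI; rewrite (effectiveP SI IS).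
split=> [cf s sc|cov p [A cA pc]]; last first.
  have [n [eps [Jeps epscov]]] := cov _ pc.
  have Ip := pg_map_Ilbar SI p; have JA := chi_bar_Jbar cA.
  have [|i ceps] :=
    fixed_cover_chi (chi := pg_chi p) pc.1.1 _ (fun i => (Jeps i).1) epscov.
    by apply/act_dom_pres => //; split=> //; exact: pg_act_dom.
  exists (eps i) => //; apply/(pres_fixP _ (Ilbar_bij Ip)) => x ex.
  have : pres (pres (pg_map p) A) (eps i) (x, x) by rewrite (Jeps i).2.
  by move=> /presE[_ /presE[]].
have Is := sc.1.1; have bs := Ilbar_bij Is.
have [t [A [It JA At sE]]] := Is.
have ds : pdom s = A by rewrite sE pdom_pres setIidl.
(* [s] may lie outside [S], so [cf] is applied to the germ of [t], which is in [Il]. *)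
have fixA chi : act_dom s chi ->
    exists2 B, chi_bar chi B & pres s B = pid B.
  move=> [Bchi]; rewrite ds => cA.
  have dt : act_dom t chi.
    by split=> //; apply: chi_bar_sub Bchi.1 cA (Jbar_pdom (Il_Ilbar It)) At.
  have [|B cB tB] := cf (mkpg (IS _ It) dt).
    by exists A => //; rewrite -sE.
  exists (A `&` B); first exact: chi_bar_setI Bchi.1.1 cA cB.
  by rewrite sE pres_pres setIA setIid setIC -pres_pres tB pres_pid.
pose fixl (l : seq (set C)) :=
  forall B, B \in l -> Jbar C B /\ pres s B = pid B.
have cpt := (compact_near_coveringP _).1 (compact_act_dom (Jbar_pdom Is)).
(* Near-covering compactness needs a filter of indices: here the lists containing a given finite
   list of fixed sets. It then provides one finite list whose members cover the whole domain. *)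
pose F : set_system (seq (set C)) := [set P | exists2 l, fixl l &
  forall l', {subset l <= l'} -> P l'].
have FF : Filter F.
  split.
  - by exists [::].
  - move=> P Q [l fl lP] [l' fl' lQ]; exists (l ++ l').
      by move=> B; rewrite mem_cat => /orP[/fl|/fl'].
    move=> k lk; split; [apply: lP|apply: lQ] => B Bl; apply: lk.
      by rewrite mem_cat Bl.
    by rewrite mem_cat Bl orbT.
  - by move=> P Q PQ [l fl lP]; exists l => // k /lP/PQ.
have [|l fl lP] := cpt (seq (set C))
    F (fun l psi => act_dom s psi -> exists2 B, B \in l & chi_bar psi B) FF.
  move=> chi dchi; have [B cB sB] := fixA _ dchi.
  exists ([set psi | Omega psi -> chi_bar psi B], [set l | B \in l]) => /=.
    split; last first.
      exists [:: B] => [D|k]; last by apply; rewrite mem_head.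
      by rewrite inE => /eqP ->; split=> //; exact: chi_bar_Jbar cB.
    apply: filterS (near_chi_bar dchi.1.1 (chi_bar_Jbar cB)) => psi + Opsi.
    by move=> ->.
  move=> [psi k] /= [pB Bk] dpsi; exists B => //; apply: pB.
  exact: dpsi.1.1.
exists (size l), (fun i => nth set0 l i); split=> [i|g Jg g0 gs].
  by apply: fl; rewrite mem_nth.
(* A maximal character with value 1 at [g] is in the domain of [s], so it has value 1 at some [B] of
   the list, and [g] meets [B]. *)
have [psi pmax pg] := Omega_max_nonempty (e := inJ Jg) g0.
have Opsi := Omega_max_Omega pmax.
have pg' : chi_bar psi g by rewrite (chi_bar_J (inJ Jg)).
have dpsi : act_dom s psi.
  split; first exact: Omega_max_bOmega.
  exact: chi_bar_sub Opsi pg' (Jbar_pdom Is) gs.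
have [B Bl pB] := lP l (fun _ h => h) _ dpsi dpsi.
have il : (index B l < size l)%N by rewrite index_mem.
exists (Ordinal il); rewrite /= nth_index//.
exact: chi_bar_nonempty Opsi (chi_bar_setI Opsi.1 pg' pB).
Qed.

(** [Ilbar] is closed under restriction to sets of [Jbar], so the restriction witnessing [germ_c]
    itself represents the germ. *)
Lemma interior_isotropy_Ilbar :
  (isotropy (Ilbar C))° = germs_of (Ilbar C) (Ilbar_c C).
Proof.
have SI : Ilbar C `<=` Ilbar C by [].
apply/seteqP; split=> g; rewrite -[g]reprK.
  move=> /(interior_isotropyP SI); move: (repr g) => p [A cA pc].
  have Ip := pg_mapP p; have JA := chi_bar_Jbar cA.
  have dA : act_dom (pres (pg_map p) A) (pg_chi p).
    by apply/act_dom_pres => //; split=> //; exact: pg_act_dom.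
  exists (mkpg (S := Ilbar C) pc.1.1 dA) => //.
  apply/pi_germP; split=> //; exists A => //.
  by rewrite [LHS]pres_pres setIid.
move: (repr g) => p [q qc <-]; apply/(interior_isotropyP SI).
exists (pdom (pg_map q)); first exact: (pg_act_dom q).2.
by apply: Ilbar_c_pres => //; apply: pg_Ilbar_f => //; exact: (pg_act_dom q).2.
Qed.

End FixedCovers.

Theorem theorem5p18 (C : lcCategory) :
  (isotropy (Ilbar C))° = germs_of (Ilbar C) (Ilbar_c C) /\
  [<-> (* (i) *) effective (Il C);
       effective (Ilbar C);
       (* (ii) *) germs_of (Ilbar C) (Ilbar_c C) = germ_units (Ilbar C);
       (* (iii) *) forall s, Ilbar_c C s ->
         exists (n : nat) (eps : 'I_n -> set C),
           (forall i, Jbar C (eps i) /\ pres s (eps i) = pid (eps i)) /\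
           (forall g, J C g -> g !=set0 -> g `<=` pdom s ->
              exists i, (g `&` eps i) !=set0)].
Proof.
split; first exact: interior_isotropy_Ilbar.
have IlI : Il C `<=` Ilbar C by move=> s; exact: Il_Ilbar.
(* The covering condition does not mention [S], so it links the effectiveness of the two
   groupoids. *)
have effIl := effective_fixed_covers (fun _ h => h) IlI.
have effIlbar := effective_fixed_covers IlI (fun _ h => h).
tfae.
- by move=> /effIl/effIlbar.
- by rewrite /effective interior_isotropy_Ilbar.
- by move=> h; apply/effIlbar; rewrite /effective interior_isotropy_Ilbar.
- by move=> h; exact/effIl.
Qed.
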